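(* Let $n\ge1$ and $G=\mathbb{R}^n\setminus\{0\}$. Then the point pair function $$p_G(x,y)=\frac{|x-y|}{\sqrt{|x-y|^2+4|x|\,|y|}},\quad x,y\in G,$$ is a metric on $G$.
   Context: Here $|\cdot|$ is the Euclidean norm on $\mathbb{R}^n$. In general, for a proper open set $G\subsetneq\mathbb{R}^n$ the point pair function is $p_G(x,y)=|x-y|/\sqrt{|x-y|^2+4d_G(x)d_G(y)}$, where $d_G(x)=\inf\{|x-z| : z\in\partial G\}$; for $G=\mathbb{R}^n\setminus\{0\}$ one has $d_G(x)=|x|$. *)

(* Defs.v *)
From HB Require Import structures.
From mathcomp Require Import all_boot all_order all_algebra.
From mathcomp Require Import all_classical all_reals all_analysis.

Set Implicit Arguments.
Unset Strict Implicit.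
Unset Printing Implicit Defensive.

Import Order.TTheory GRing.Theory Num.Theory.
Import numFieldNormedType.Exports.

Local Open Scope classical_set_scope.
Local Open Scope ring_scope.

(* R^n is 'rV[R]_n. Its library norm `|x| is the sup norm, hence [enorm] for
   the Euclidean one; the library topology on 'rV[R]_n is the product topology,
   which is also the one induced by [enorm]. *)
Definition enorm (R : realType) (n : nat) (x : 'rV[R]_n) : R :=
  Num.sqrt (\sum_(i < n) x ord0 i ^+ 2).

Definition boundary (T : topologicalType) (A : set T) : set T :=
  closure A `\` interior A.

(* [inf] is meaningful here when G is neither empty nor the whole space, as
   [boundary G] is then nonempty ([inf set0] is 0 by convention). *)
Definition boundary_dist (R : realType) (n : nat) (G : set 'rV[R]_n)
    (x : 'rV[R]_n) : R :=
  inf [set enorm (x - z) | z in boundary G].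

Definition point_pair (R : realType) (n : nat) (G : set 'rV[R]_n)
    (x y : 'rV[R]_n) : R :=
  enorm (x - y) /
  Num.sqrt (enorm (x - y) ^+ 2 + 4 * boundary_dist G x * boundary_dist G y).

Definition is_metric_on (R : realType) (T : Type) (A : set T)
    (d : T -> T -> R) : Prop :=
  [/\ forall x y, A x -> A y -> 0 <= d x y,
      forall x y, A x -> A y -> (d x y = 0 <-> x = y),
      forall x y, A x -> A y -> d x y = d y x
    & forall x y z, A x -> A y -> A z -> d x z <= d x y + d y z].

Definition punctured_space (R : realType) (n : nat) : set 'rV[R]_n :=
  ~` [set 0].

(* Main.v *)
(** Put [a = |x|], [b = |y|].  Then [|x-y|^2 / (4ab) = rho^2 + sigma^2] with
    [rho = (a-b) / (2 sqrt (ab)) = sinh ((log a - log b) / 2)] and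
    [sigma = |x/a - y/b| / 2].  If [s = sqrt (rho^2 + sigma^2) = sinh u], then
    the point pair function is [tanh u].  The addition formula for [sinh]
    controls [rho], the triangle inequality on the sphere controls [sigma], and
    Minkowski's inequality in the plane combines them into
    [sinh u_xz <= sinh (u_xy + u_yz)]; finally [tanh] is increasing and
    subadditive on the half-line. *)
Require Import Defs.
From mathcomp Require Import all_boot all_order all_algebra.
From mathcomp Require Import all_classical all_reals all_analysis.
From mathcomp Require Import ring lra.
Import Order.TTheory GRing.Theory Num.Theory.
Import numFieldNormedType.Exports.
Local Open Scope classical_set_scope.
Local Open Scope ring_scope.

(** * Euclidean inner product and norm *)

Section Enorm.
Context {R : realType} {n : nat}.
Implicit Types (x y z : 'rV[R]_n) (k : R).

Definition dot x y : R := \sum_(i < n) x ord0 i * y ord0 i.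

Lemma dotC x y : dot x y = dot y x.
Proof. by apply: eq_bigr => i _; rewrite mulrC. Qed.

Lemma dotDl x y z : dot (x + y) z = dot x z + dot y z.
Proof. by rewrite -big_split; apply: eq_bigr => i _; rewrite mxE mulrDl. Qed.

Lemma dotZl k x y : dot (k *: x) y = k * dot x y.
Proof. by rewrite /dot mulr_sumr; apply: eq_bigr => i _; rewrite mxE mulrA. Qed.

Lemma dotBZ k l x y : dot (k *: x - l *: y) (k *: x - l *: y) =
  k ^+ 2 * dot x x + l ^+ 2 * dot y y - 2 * k * l * dot x y.
Proof.
rewrite -scaleNr dotDl !dotZl !(dotC _ (_ + _)) !dotDl !dotZl (dotC y x).
by ring.
Qed.

Lemma dot_ge0 x : 0 <= dot x x.
Proof. by apply: sumr_ge0 => i _; rewrite -expr2 sqr_ge0. Qed.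

Lemma sqr_enorm x : enorm x ^+ 2 = dot x x.
Proof.
have e : \sum_(i < n) x ord0 i ^+ 2 = dot x x.
  by apply: eq_bigr => i _; rewrite expr2.
by rewrite /enorm e sqr_sqrtr ?dot_ge0.
Qed.

Lemma enorm_ge0 x : 0 <= enorm x. Proof. exact: sqrtr_ge0. Qed.

Lemma enorm_eq0 x : enorm x = 0 -> x = 0.
Proof.
move=> x0; have /eqP : dot x x = 0 by rewrite -sqr_enorm x0 expr0n.
rewrite psumr_eq0 => [/allP h|i _]; last by rewrite -expr2 sqr_ge0.
apply/rowP => i; rewrite mxE; apply/eqP.
by have := h i (mem_index_enum _); rewrite -expr2 sqrf_eq0.
Qed.

Lemma enorm0 : enorm (0 : 'rV[R]_n) = 0.
Proof.
rewrite /enorm big1 ?sqrtr0 // => i _.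
by rewrite mxE expr0n.
Qed.

Lemma enorm_gt0 x : x <> 0 -> 0 < enorm x.
Proof.
move=> x0; rewrite lt_neqAle enorm_ge0 andbT eq_sym.
by apply/eqP => /enorm_eq0.
Qed.

Lemma enormBC x y : enorm (x - y) = enorm (y - x).
Proof. by rewrite /enorm; congr Num.sqrt; apply: eq_bigr => i _; rewrite !mxE; ring. Qed.

(** Cauchy-Schwarz: for nonzero vectors, the squared norm of [|y| x - |x| y] equals
    [2 |x| |y| (|x| |y| - dot x y)]. *)
Lemma dot_le x y : dot x y <= enorm x * enorm y.
Proof.
have [->|/eqP /enorm_gt0 x0] := eqVneq x 0.
  by rewrite enorm0 mul0r /dot big1 // => i _; rewrite mxE mul0r.
have [->|/eqP /enorm_gt0 y0] := eqVneq y 0.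
  by rewrite enorm0 mulr0 /dot big1 // => i _; rewrite mxE mulr0.
have := dot_ge0 (enorm y *: x - enorm x *: y).
rewrite dotBZ -!sqr_enorm => h.
have xy0 := mulr_gt0 x0 y0.
rewrite -subr_ge0 -(pmulr_rge0 _ xy0); lra.
Qed.

Lemma enormD x y : enorm (x + y) <= enorm x + enorm y.
Proof.
rewrite -ler_sqr ?nnegrE ?addr_ge0 ?enorm_ge0 // sqr_enorm.
rewrite dotDl !(dotC _ (_ + _)) !dotDl (dotC y x) sqrrD !sqr_enorm.
by have := dot_le x y; lra.
Qed.

Lemma enorm_dist x y z : enorm (x - z) <= enorm (x - y) + enorm (y - z).
Proof. by rewrite -(subrKA y x) enormD. Qed.

End Enorm.

(** * Boundary of the punctured space *)

Lemma closed_set1_rV (R : realType) n : closed [set (0 : 'rV[R]_n)].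
Proof.
apply: accessible_closed_set1; apply: hausdorff_accessible.
exact: norm_hausdorff.
Qed.

(** The origin is closed with empty interior, so its complement is open and dense. *)
Lemma boundary_punctured (R : realType) n : (1 <= n)%N ->
  boundary (@punctured_space R n) = [set 0].
Proof.
move=> n_gt0; rewrite /boundary /punctured_space.
rewrite -[closure _]setCK -interiorC setCK.
have -> : (~` [set (0 : 'rV[R]_n)])° = ~` [set 0].
  apply: (iffLR (interior_id _)); exact: closed_openC (closed_set1_rV R n).
suff -> : [set (0 : 'rV[R]_n)]° = set0 by rewrite setC0 setTD setCK.
rewrite -subset0 => x; rewrite /interior /= => hx.
have x0 : x = 0 by exact: nbhs_singleton hx.
move: hx; rewrite {}x0 => /nbhs_ballP[e /= e0 he].
(* This vector lies in the sup-norm ball of radius [e] about 0, yet its coordinate of index 0, which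
   exists as [1 <= n], is nonzero. *)
have : (const_mx (e / 2) : 'rV[R]_n) = 0.
  apply: he; split=> // i j; rewrite !mxE /ball /= sub0r normrN gtr0_norm; lra.
move=> /rowP /(_ (Ordinal n_gt0)); rewrite !mxE; lra.
Qed.

Lemma boundary_dist_punctured (R : realType) n (x : 'rV[R]_n) : (1 <= n)%N ->
  boundary_dist (@punctured_space R n) x = enorm x.
Proof.
by move=> n0; rewrite /boundary_dist boundary_punctured // image_set1 subr0 inf1.
Qed.

(** * Plane and hyperbolic inequalities *)

Lemma minkowski_plane (R : rcfType) (r1 r2 t1 t2 : R) :
  Num.sqrt ((r1 + r2) ^+ 2 + (t1 + t2) ^+ 2) <=
  Num.sqrt (r1 ^+ 2 + t1 ^+ 2) + Num.sqrt (r2 ^+ 2 + t2 ^+ 2).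
Proof.
have h (r t : R) : 0 <= r ^+ 2 + t ^+ 2 by rewrite addr_ge0 ?sqr_ge0.
rewrite -ler_sqr ?nnegrE ?addr_ge0 ?sqrtr_ge0 // [leRHS]sqrrD !sqr_sqrtr //.
suff : r1 * r2 + t1 * t2 <= Num.sqrt (r1 ^+ 2 + t1 ^+ 2) * Num.sqrt (r2 ^+ 2 + t2 ^+ 2).
  lra.
rewrite -sqrtrM //; apply: (le_trans (ler_norm _)).
rewrite -sqrtr_sqr ler_wsqrtr // -subr_ge0.
(* Lagrange's identity: the difference is exactly this square. *)
by have := sqr_ge0 (r1 * t2 - r2 * t1); lra.
Qed.

(* With [sinh u = s]: if [sinh u <= sinh (u1 + u2)] then
   [tanh u <= tanh u1 + tanh u2]. *)
Lemma tanh_subadditive (R : rcfType) (s s1 s2 : R) :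
  let c t := Num.sqrt (1 + t ^+ 2) in
  0 <= s -> 0 <= s1 -> 0 <= s2 -> s <= s1 * c s2 + s2 * c s1 ->
  s / c s <= s1 / c s1 + s2 / c s2.
Proof.
move=> c s_ge0 s1_ge0 s2_ge0 hs.
have c_gt0 t : 0 < c t by rewrite sqrtr_gt0; have := sqr_ge0 t; lra.
have cE t : c t ^+ 2 = 1 + t ^+ 2.
  by rewrite sqr_sqrtr //; have := sqr_ge0 t; lra.
have -> : s1 / c s1 + s2 / c s2 = (s1 * c s2 + s2 * c s1) / (c s1 * c s2).
  by field; rewrite !gt_eqF.
set S := s1 * c s2 + _ in hs *.
have S_ge0 : 0 <= S by exact: le_trans hs.
have c12 : 0 < c s1 * c s2 by rewrite mulr_gt0.
(* As [S] is [sinh (u1 + u2)], [c S] is [cosh (u1 + u2)], which exceeds the product of the two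
   [cosh] by [s1 * s2 >= 0]. *)
have cS : c s1 * c s2 <= c S.
  rewrite -ler_sqr ?nnegrE ?(ltW c12) ?(ltW (c_gt0 _)) // cE exprMn !cE.
  have -> : 1 + S ^+ 2 =
      1 + s1 ^+ 2 * (c s2) ^+ 2 + s2 ^+ 2 * (c s1) ^+ 2 + 2 * (s1 * s2 * (c s1 * c s2)).
    by rewrite /S; ring.
  rewrite !cE.
  have := mulr_ge0 (mulr_ge0 s1_ge0 s2_ge0) (ltW c12).
  by have := mulr_ge0 (sqr_ge0 s1) (sqr_ge0 s2); lra.
apply: (@le_trans _ _ (S / c S)); last first.
  by rewrite ler_wpM2l // lef_pV2 ?posrE.
(* Monotonicity of [tanh]: cross-multiplied and squared, it reduces to [s ^+ 2 <= S ^+ 2]. *)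
rewrite ler_pdivrMr // mulrAC ler_pdivlMr //.
rewrite -ler_sqr ?nnegrE ?mulr_ge0 ?(ltW (c_gt0 _)) //.
rewrite !exprMn !cE.
have : s ^+ 2 <= S ^+ 2 by rewrite ler_sqr ?nnegrE.
lra.
Qed.

(** * Radial and angular parts of the point pair function *)

Section PointPair.
Context {R : realType} {n : nat}.
Implicit Types x y z : 'rV[R]_n.

Definition radial x y : R :=
  (enorm x - enorm y) / (2 * (Num.sqrt (enorm x) * Num.sqrt (enorm y))).

Definition angular x y : R :=
  enorm ((enorm x)^-1 *: x - (enorm y)^-1 *: y) / 2.

Definition pp_sinh x y : R := Num.sqrt (radial x y ^+ 2 + angular x y ^+ 2).

Definition pp_cosh x y : R := Num.sqrt (1 + pp_sinh x y ^+ 2).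

(** Law of cosines in polar form: [|x - y|^2 = (|x| - |y|)^2 + |x| |y| |x/|x| - y/|y||^2]. *)
Lemma sqr_pp_sinh x y : x <> 0 -> y <> 0 ->
  pp_sinh x y ^+ 2 = enorm (x - y) ^+ 2 / (4 * enorm x * enorm y).
Proof.
move=> /enorm_gt0 x0 /enorm_gt0 y0.
rewrite sqr_sqrtr ?addr_ge0 ?sqr_ge0 // /radial /angular !expr_div_n !exprMn.
rewrite (sqr_sqrtr (ltW x0)) (sqr_sqrtr (ltW y0)).
rewrite -[x - y]scale1r scalerBr !sqr_enorm !dotBZ -!sqr_enorm.
by field; rewrite !gt_eqF.
Qed.

Lemma pp_tanhE x y : x <> 0 -> y <> 0 ->
  enorm (x - y) / Num.sqrt (enorm (x - y) ^+ 2 + 4 * enorm x * enorm y) =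
  pp_sinh x y / pp_cosh x y.
Proof.
move=> xn0 yn0; have x0 := enorm_gt0 _ xn0; have y0 := enorm_gt0 _ yn0.
have p0 : 0 < 4 * enorm x * enorm y by rewrite !mulr_gt0.
have d0 : 0 < enorm (x - y) ^+ 2 + 4 * enorm x * enorm y.
  by rewrite ltr_wpDl ?sqr_ge0.
apply/eqP; rewrite -(@eqrXn2 _ 2) // ?divr_ge0 ?sqrtr_ge0 ?enorm_ge0 //.
have c0 : 0 <= 1 + pp_sinh x y ^+ 2 by rewrite addr_ge0 ?sqr_ge0.
rewrite !expr_div_n (sqr_sqrtr (ltW d0)) (sqr_sqrtr c0) sqr_pp_sinh //.
by apply/eqP; field; rewrite !gt_eqF //= addrC.
Qed.

Lemma pp_cosh_gt0 x y : 0 < pp_cosh x y.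
Proof. by rewrite sqrtr_gt0 ltr_wpDr ?sqr_ge0. Qed.

Lemma pp_cosh_ge1 x y : 1 <= pp_cosh x y.
Proof. by rewrite -[leLHS]sqrtr1 ler_wsqrtr // lerDl sqr_ge0. Qed.

(* The left-hand side is [cosh ((log |x| - log |y|) / 2)]. *)
Lemma radial_cosh_le x y : x <> 0 -> y <> 0 ->
  (enorm x + enorm y) / (2 * (Num.sqrt (enorm x) * Num.sqrt (enorm y))) <=
  pp_cosh x y.
Proof.
move=> /enorm_gt0 x0 /enorm_gt0 y0.
have sx0 : 0 < Num.sqrt (enorm x) by rewrite sqrtr_gt0.
have sy0 : 0 < Num.sqrt (enorm y) by rewrite sqrtr_gt0.
set l := leLHS; rewrite (le_trans (ler_norm l)) // -sqrtr_sqr ler_wsqrtr //.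
rewrite sqr_sqrtr ?addr_ge0 ?sqr_ge0 //.
(* This is [cosh^2 = 1 + sinh^2]; [pp_cosh] has the angular square in addition. *)
suff -> : l ^+ 2 = 1 + radial x y ^+ 2 by rewrite addrA lerDl sqr_ge0.
rewrite /l /radial !expr_div_n !exprMn !sqr_sqrtr ?ltW //.
by field; rewrite !gt_eqF.
Qed.

(* The addition formula for [sinh]. *)
Lemma radial_add x y z : x <> 0 -> y <> 0 -> z <> 0 ->
  `|radial x z| <= `|radial x y| * pp_cosh y z + `|radial y z| * pp_cosh x y.
Proof.
move=> xn0 yn0 zn0.
have x0 := enorm_gt0 _ xn0; have y0 := enorm_gt0 _ yn0.
have z0 := enorm_gt0 _ zn0.
pose C (u v : 'rV[R]_n) : R :=
  (enorm u + enorm v) / (2 * (Num.sqrt (enorm u) * Num.sqrt (enorm v))).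
have C_ge0 u v : 0 <= C u v.
  by rewrite divr_ge0 ?addr_ge0 ?enorm_ge0 // !mulr_ge0 ?sqrtr_ge0.
have -> : radial x z = radial x y * C y z + radial y z * C x y.
  rewrite /radial /C.
  have sqrt_gt0 (u : R) : 0 < u -> 0 < Num.sqrt u by rewrite sqrtr_gt0.
  (* Writing each norm as the square of its root makes the identity rational in the three roots. *)
  move: (sqrt_gt0 _ x0) (sqrt_gt0 _ y0) (sqrt_gt0 _ z0).
  move: (esym (sqr_sqrtr (ltW x0))) (esym (sqr_sqrtr (ltW y0))).
  move: (esym (sqr_sqrtr (ltW z0))).
  move: (Num.sqrt (enorm x)) (Num.sqrt (enorm y)) (Num.sqrt (enorm z)).
  move=> a b c -> -> -> a0 b0 c0.
  by field; rewrite !gt_eqF.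
apply: (le_trans (ler_normD _ _)); rewrite (normrM (radial x y) (C y z)).
rewrite (normrM (radial y z) (C x y)) (ger0_norm (C_ge0 y z)).
rewrite (ger0_norm (C_ge0 x y)).
by rewrite lerD // ler_wpM2l // radial_cosh_le.
Qed.

Lemma angular_ge0 x y : 0 <= angular x y.
Proof. by rewrite divr_ge0 ?enorm_ge0. Qed.

(** The chordal triangle inequality already holds without the factors [pp_cosh >= 1]; they give the
    same weights as in [radial_add], as Minkowski's inequality requires. *)
Lemma angular_add x y z :
  angular x z <= angular x y * pp_cosh y z + angular y z * pp_cosh x y.
Proof.
apply: (@le_trans _ _ (angular x y + angular y z)).
  rewrite -mulrDl ler_wpM2r ?invr_ge0 //; exact: enorm_dist.
by rewrite lerD // ler_peMr ?angular_ge0 ?pp_cosh_ge1.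
Qed.

Lemma pp_sinh_add x y z : x <> 0 -> y <> 0 -> z <> 0 ->
  pp_sinh x z <= pp_sinh x y * pp_cosh y z + pp_sinh y z * pp_cosh x y.
Proof.
move=> x0 y0 z0.
(* Each product becomes the length of a scaled plane vector; the absolute value makes its radial
   coordinate the one bounded in [radial_add]. *)
have scale r t k : 0 <= k -> Num.sqrt (r ^+ 2 + t ^+ 2) * k =
    Num.sqrt ((`|r| * k) ^+ 2 + (t * k) ^+ 2) :> R.
  move=> k0; rewrite -{1}(ger0_norm k0) -sqrtr_sqr -sqrtrM ?addr_ge0 ?sqr_ge0 //.
  by rewrite mulrDl !exprMn real_normK ?num_real.
rewrite [pp_sinh x y]/pp_sinh [pp_sinh y z]/pp_sinh.
rewrite !scale ?(ltW (pp_cosh_gt0 _ _)) //.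
apply: le_trans (minkowski_plane _ _ _ _ _); apply: ler_wsqrtr; apply: lerD.
  rewrite -real_normK ?num_real // ler_sqr ?nnegrE ?radial_add //.
  by rewrite addr_ge0 ?mulr_ge0 ?(ltW (pp_cosh_gt0 _ _)).
rewrite ler_sqr ?nnegrE ?angular_add ?angular_ge0 //.
by apply: addr_ge0; apply: mulr_ge0; rewrite ?angular_ge0 ?(ltW (pp_cosh_gt0 _ _)).
Qed.

End PointPair.

Theorem theorem4p6 (R : realType) (n : nat) (hn : (1 <= n)%N) :
  let G := @punctured_space R n in
  (forall x y : 'rV[R]_n, G x -> G y ->
     point_pair G x y =
       enorm (x - y) /
       Num.sqrt (enorm (x - y) ^+ 2 + 4 * enorm x * enorm y))
  /\ is_metric_on G (point_pair G).
Proof.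
move=> G.
have ppE x y : point_pair G x y = enorm (x - y) /
    Num.sqrt (enorm (x - y) ^+ 2 + 4 * enorm x * enorm y).
  by rewrite /point_pair !boundary_dist_punctured.
split=> [x y _ _|]; first exact: ppE.
split=> [x y _ _|x y x0 y0|x y _ _|x y z x0 y0 z0]; rewrite !ppE.
- by rewrite divr_ge0 ?enorm_ge0 ?sqrtr_ge0.
- split=> [/eqP|->]; last by rewrite subrr enorm0 mul0r.
  rewrite mulf_eq0 invr_eq0 => /orP[/eqP/enorm_eq0/subr0_eq //|].
  (* The inverse of the root cannot vanish, since [4 |x| |y| > 0] off the origin. *)
  rewrite gt_eqF // sqrtr_gt0 ltr_wpDl ?sqr_ge0 //.
  by rewrite !mulr_gt0 // enorm_gt0.
- by rewrite enormBC mulrAC.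
- rewrite !pp_tanhE //; apply: tanh_subadditive; rewrite ?sqrtr_ge0 //.
  exact: pp_sinh_add.
Qed.
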